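(* Let $\Omega\subset\mathbb{R}^3$ be a bounded domain with $\partial\Omega\in C^{1,\alpha}$, $0<\alpha\le 1$. Then $\Omega$ satisfies a uniform exterior cone condition, that is: there exists a fixed finite right circular cone $K$ such that each $P=(x,y,z)^T\in\partial\Omega$ is the vertex of a cone $K(P)$ with $\overline{K(P)}\cap\overline{\Omega}=\{P\}$ and $K(P)$ congruent to $K$.
   Context: $\partial\Omega\in C^{1,\alpha}$ means: each point of $\partial\Omega$ has a neighbourhood (ball) in which $\partial\Omega$ is the graph of a $C^{1,\alpha}$ function of two of the three coordinates $x,y,z$, with $\Omega$ lying (locally) on exactly one side of the graph. *)

(* Defs.v *)
From mathcomp Require Import all_boot all_order all_algebra.
From mathcomp Require Import all_classical all_reals all_analysis.

Set Implicit Arguments.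
Unset Strict Implicit.
Unset Printing Implicit Defensive.

Import Order.TTheory GRing.Theory Num.Theory.
Import numFieldNormedType.Exports.

Local Open Scope classical_set_scope.
Local Open Scope ring_scope.

(* The library norm on 'rV[R]_n is the sup norm. It induces the usual topology
   and the usual bounded sets, but balls, cones and congruences need the
   Euclidean geometry, hence [dotp] and [enorm]. *)

Definition dotp (R : realType) (n : nat) (u v : 'rV[R]_n) : R :=
  \sum_(j < n) u 0 j * v 0 j.

Definition enorm (R : realType) (n : nat) (u : 'rV[R]_n) : R :=
  Num.sqrt (dotp u u).

Definition eball (R : realType) (n : nat) (P : 'rV[R]_n) (r : R) :
    set 'rV[R]_n :=
  [set Q | enorm (Q - P) < r].

Definition boundary (T : topologicalType) (A : set T) : set T :=
  closure A `\` interior A.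

Definition is_domain (R : realType) (n : nat) (A : set 'rV[R]_n) : Prop :=
  [/\ open A, connected A & A !=set0].

Definition holder_on (R : realType) (n : nat) (alpha : R)
    (U : set 'rV[R]_n) (g : 'rV[R]_n -> R) : Prop :=
  exists C : R, forall u v : 'rV[R]_n, U u -> U v ->
    `|g u - g v| <= C * enorm (u - v) `^ alpha.

(* [g] is defined on the whole space, but only its values on the open set [U]
   are relevant. *)
Definition C1alpha_on (R : realType) (n : nat) (alpha : R)
    (U : set 'rV[R]_n) (g : 'rV[R]_n -> R) : Prop :=
  forall j : 'I_n,
    [/\ forall u, U u -> derivable g u (delta_mx 0 j),
        forall u, U u -> {for u, continuous (fun v => 'D_(delta_mx 0 j) g v)}
      & holder_on alpha U (fun v => 'D_(delta_mx 0 j) g v)].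

(* [col' i Q] consists of the two coordinates of [Q] other than [Q 0 i]. The
   sign [below] is chosen once for the whole ball: Omega occupies the points
   under the graph and none over it, or the other way round. *)
Definition C1alpha_boundary (R : realType) (alpha : R)
    (Omega : set 'rV[R]_3) : Prop :=
  forall P : 'rV[R]_3, boundary Omega P ->
  exists (r : R) (i : 'I_3) (U : set 'rV[R]_2) (g : 'rV[R]_2 -> R)
         (below : bool),
    [/\ 0 < r,
        open U /\ C1alpha_on alpha U g,
        forall Q, eball P r Q ->
          (boundary Omega Q <-> U (col' i Q) /\ Q 0 i = g (col' i Q))
      & forall Q, eball P r Q -> U (col' i Q) ->
          (Omega Q <-> if below then Q 0 i < g (col' i Q)
                                else g (col' i Q) < Q 0 i)].

(* Solid cone with vertex [V], unit axis direction [d] (from the vertex to the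
   base), height [H] and base radius [rho]. The point at parameter [t] along
   the axis carries an orthogonal disk of radius rho * t / H. *)
Definition right_circular_cone (R : realType) (V d : 'rV[R]_3) (H rho : R) :
    set 'rV[R]_3 :=
  [set Q | let t := dotp (Q - V) d in
           0 <= t <= H /\ H * enorm (Q - V - t *: d) <= rho * t].

Definition is_cone_with_vertex (R : realType) (V : 'rV[R]_3)
    (K : set 'rV[R]_3) : Prop :=
  exists (d : 'rV[R]_3) (H rho : R),
    [/\ enorm d = 1, 0 < H, 0 < rho & K = right_circular_cone V d H rho].

Definition congruent (R : realType) (n : nat) (A B : set 'rV[R]_n) : Prop :=
  exists T : 'rV[R]_n -> 'rV[R]_n,
    (forall u v, enorm (T u - T v) = enorm (u - v)) /\ T @` A = B.

Definition uniform_exterior_cone (R : realType) (Omega : set 'rV[R]_3) : Prop :=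
  exists K : set 'rV[R]_3,
    (exists V, is_cone_with_vertex V K) /\
    forall P, boundary Omega P ->
      exists KP : set 'rV[R]_3,
        [/\ is_cone_with_vertex P KP,
            closure KP `&` closure Omega = [set P]
          & congruent KP K].

(* Main.v *)
Require Import Defs.
From mathcomp Require Import all_boot all_order all_algebra.
From mathcomp Require Import all_classical all_reals all_analysis.
From mathcomp Require Import ring lra.

Import Order.TTheory GRing.Theory Num.Theory.
Import numFieldNormedType.Exports.

Local Open Scope classical_set_scope.
Local Open Scope ring_scope.

(** Near each boundary point [P], [Omega] lies on one side of the graph of a
function [g] with continuous partial derivatives, and such a function is locally
Lipschitz ([C1_locally_lipschitz]). If [L] is a Lipschitz constant, let a cone with
vertex [Q] on the graph open along the coordinate axis of the graph, away from
[Omega]. A point of the cone at height [t] above [Q] is displaced sideways by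
at most [s * t], where [s] is the slope of the cone, so the graph rises by at
most [L * s * t] on the way to it. When [L * s < 1] this is less than [t]
unless [t = 0], so the cone meets the closure of [Omega] only at its vertex
([exterior_cone_near]).

To make the cone uniform, take the one-parameter family of cones of height [s]
and radius [s ^+ 2], hence of slope [s]. The local argument works for all [Q]
near [P] and all sufficiently small positive [s]; compactness of the boundary
([compact_boundary]) then gives one [s] that works at every boundary point.
Finally, two cones with the same height and radius are congruent, by a
reflection that exchanges their axes followed by a translation
([congruent_cones]). *)

(** * The Euclidean inner product *)

Section InnerProduct.
Context {R : realType} {n : nat}.
Implicit Types u v w : 'rV[R]_n.

Lemma dotpC u v : dotp u v = dotp v u.
Proof. by apply: eq_bigr => j _; rewrite mulrC. Qed.

Lemma dotpDl u v w :
  dotp (u + v) w = dotp u w + dotp v w.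
Proof. by rewrite -big_split; apply: eq_bigr => j _; rewrite mxE mulrDl. Qed.

Lemma dotpZl a u w :
  dotp (a *: u) w = a * dotp u w.
Proof. by rewrite /dotp mulr_sumr; apply: eq_bigr => j _; rewrite mxE mulrA. Qed.

Lemma dotpBl u v w :
  dotp (u - v) w = dotp u w - dotp v w.
Proof. by rewrite dotpDl -scaleN1r dotpZl mulN1r. Qed.

Lemma dotpBr u v w :
  dotp w (u - v) = dotp w u - dotp w v.
Proof. by rewrite dotpC dotpBl !(dotpC w). Qed.

Lemma dotpZr a u w :
  dotp u (a *: w) = a * dotp u w.
Proof. by rewrite dotpC dotpZl dotpC. Qed.

Lemma dotp_delta u (i : 'I_n) :
  dotp u (delta_mx 0 i) = u 0 i.
Proof.
rewrite /dotp (bigD1 i) //= mxE !eqxx mulr1 big1 ?addr0 // => j ji.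
by rewrite mxE (negPf ji) andbF mulr0.
Qed.

Lemma dotp_ge0 u : 0 <= dotp u u.
Proof. by apply: sumr_ge0 => j _; rewrite -expr2 sqr_ge0. Qed.

Lemma coord_le_enorm u (j : 'I_n) :
  `|u 0 j| <= enorm u.
Proof.
rewrite -sqrtr_sqr ler_sqrt ?dotp_ge0// /dotp (bigD1 j) //= -expr2 lerDl.
by apply: sumr_ge0 => k _; rewrite -expr2 sqr_ge0.
Qed.

Lemma enorm_eq0 u : enorm u = 0 -> u = 0.
Proof.
move=> u0; apply/rowP => j; rewrite mxE; apply/eqP.
by rewrite -normr_eq0 eq_le normr_ge0 andbT -u0 coord_le_enorm.
Qed.

Lemma dotp_eq0 u : dotp u u = 0 -> u = 0.
Proof. by move=> u0; apply: enorm_eq0; rewrite /enorm u0 sqrtr0. Qed.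

Lemma dotp_unit u :
  enorm u = 1 -> dotp u u = 1.
Proof. by move=> u1; rewrite -(sqr_sqrtr (dotp_ge0 u)) -/(enorm u) u1 expr1n. Qed.

Lemma enormN u : enorm (- u) = enorm u.
Proof. by rewrite /enorm -scaleN1r dotpZl dotpZr mulrA mulrNN !mul1r. Qed.

Lemma enorm_delta (i : 'I_n) :
  enorm (delta_mx 0 i : 'rV[R]_n) = 1.
Proof. by rewrite /enorm dotp_delta mxE !eqxx sqrtr1. Qed.

Lemma continuous_dotp (T : topologicalType) (f g : T -> 'rV[R]_n) :
  continuous f -> continuous g -> continuous (fun x => dotp (f x) (g x)).
Proof.
move=> cf cg; rewrite /dotp; elim: (index_enum _) => [|j r ih] x.
  by under eq_fun do rewrite big_nil; exact: cvg_cst.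
under eq_fun do rewrite big_cons.
have coord h : continuous h -> {for x, continuous (fun y => (h y : 'rV[R]_n) 0 j)}.
  move=> ch; apply: (@continuous_comp _ _ _ h (fun M : 'rV[R]_n => M 0 j)).
    exact: ch.
  exact: coord_continuous.
by apply: cvgD; [apply: cvgM; exact: coord|exact: ih].
Qed.

Lemma continuous_enorm : continuous (@enorm R n).
Proof.
move=> u; apply: (@continuous_comp _ _ _ (fun v => dotp v v)).
  by apply: continuous_dotp => v; exact: cvg_id.
exact: sqrt_continuous.
Qed.

End InnerProduct.

(** * Right circular cones *)

Section Reflection.
Context {R : realType} {n : nat}.
Implicit Types u v w d : 'rV[R]_n.

(** For [w <> 0] this is the Householder reflection in the hyperplane orthogonal
to [w]. For [w = 0] it is the identity, because division by zero gives zero, so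
that the facts below hold for every [w]. *)
Definition reflection w u :=
  u - (2 * dotp u w / dotp w w) *: w.

Lemma reflectionB w u v :
  reflection w (u - v) = reflection w u - reflection w v.
Proof.
rewrite /reflection dotpBl mulrBr mulrBl scalerBl.
by apply/rowP => j; rewrite !mxE; ring.
Qed.

Lemma reflectionZ w a u : reflection w (a *: u) = a *: reflection w u.
Proof.
by rewrite /reflection dotpZl; apply/rowP => j; rewrite !mxE; ring.
Qed.

Lemma dotp_reflection w u v :
  dotp (reflection w u) (reflection w v) = dotp u v.
Proof.
rewrite /reflection !dotpBl !dotpBr !dotpZl !dotpZr (dotpC w v).
have [w0|w0] := eqVneq (dotp w w) 0; last by field.
by rewrite w0 invr0; ring.
Qed.

Lemma enorm_reflection w u : enorm (reflection w u) = enorm u.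
Proof. by rewrite /enorm dotp_reflection. Qed.

Lemma reflectionK w : involutive (reflection w).
Proof.
move=> u; rewrite /reflection dotpBl dotpZl.
have [/dotp_eq0 ->|w0] := eqVneq (dotp w w) 0; first by rewrite !scaler0 !subr0.
by apply/rowP => j; rewrite !mxE; field.
Qed.

(** Since [d] and [d'] have the same length, the hyperplane orthogonal to
[d - d'] contains their midpoint. *)
Lemma reflection_swap d d' :
  enorm d = 1 -> enorm d' = 1 -> reflection (d - d') d = d'.
Proof.
move=> /dotp_unit d1 /dotp_unit d'1.
have [/eqP|dd'] := eqVneq (dotp (d - d') (d - d')) 0.
  move=> /eqP /dotp_eq0 w0; rewrite w0 /reflection scaler0 subr0.
  by apply/eqP; rewrite -subr_eq0 w0.
suff -> : reflection (d - d') d = d - 1 *: (d - d').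
  by rewrite scale1r opprB addrC subrK.
congr (_ - _ *: _); move: dd'.
rewrite !dotpBl !dotpBr d1 d'1 (dotpC d' d) => dd'.
by field.
Qed.

End Reflection.

(** A linear isometry preserves the inner product and the norm, which are all
that the definition of a cone uses; it remains to choose one that maps one axis
to the other. *)
Lemma congruent_cones (R : realType) (V V' d d' : 'rV[R]_3) (H rho : R) :
  enorm d = 1 -> enorm d' = 1 ->
  congruent (right_circular_cone V d H rho) (right_circular_cone V' d' H rho).
Proof.
move=> d1 d'1; pose f : 'rV[R]_3 -> 'rV[R]_3 := reflection (d - d').
have fd : f d = d' by exact: reflection_swap.
have coneE u : right_circular_cone V d H rho u =
    right_circular_cone V' d' H rho (V' + f (u - V)).
  rewrite /right_circular_cone /= (addrC V') addrK -fd dotp_reflection.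
  by rewrite -reflectionZ -reflectionB enorm_reflection.
exists (fun u => V' + f (u - V)); split.
  move=> u v; rewrite opprD addrACA subrr add0r -reflectionB enorm_reflection.
  by rewrite opprB addrA subrK.
apply/seteqP; split => [_ [u + <-]|u Ku]; first by rewrite coneE.
have fK : V' + f (V + f (u - V') - V) = u.
  by rewrite (addrC V) addrK /f reflectionK (addrC V') subrK.
by exists (V + f (u - V')) => //; rewrite /= coneE fK.
Qed.

Lemma closed_cone (R : realType) (V d : 'rV[R]_3) (H rho : R) :
  closed (right_circular_cone V d H rho).
Proof.
pose t (Q : 'rV[R]_3) := dotp (Q - V) d.
have cB : continuous (fun Q : 'rV[R]_3 => Q - V).
  by move=> Q; apply: continuousB; [exact: cvg_id|exact: cst_continuous].
have ct : continuous t by apply: continuous_dotp cB _; exact: cst_continuous.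
have ctd : continuous (fun Q => t Q *: d).
  by move=> Q; apply: continuousZr_tmp; exact: ct.
have ch : continuous (fun Q : 'rV[R]_3 => Q - V - t Q *: d).
  by move=> Q; exact: (cvgB (cB Q) (ctd Q)).
have cle (f g : 'rV[R]_3 -> R) : continuous f -> continuous g ->
    closed [set Q | f Q <= g Q].
  move=> cf cg; rewrite (_ : mkset _ = (fun Q => f Q - g Q) @^-1` [set x | x <= 0]).
    apply: preimage_closed; last exact: closed_le.
    by move=> Q _; exact: (cvgB (cf Q) (cg Q)).
  by apply/seteqP; split => Q /=; rewrite subr_le0.
rewrite (_ : right_circular_cone V d H rho =
  [set Q | 0 <= t Q] `&` [set Q | t Q <= H] `&`
  [set Q | H * enorm (Q - V - t Q *: d) <= rho * t Q]); last first.
  by apply/seteqP; split => [Q [/andP[]]|Q [[/= t0 tH] ?]] //; split => //; apply/andP.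
apply: closedI; first by apply: closedI; apply: cle => //; exact: cst_continuous.
have ce : continuous (fun Q : 'rV[R]_3 => enorm (Q - V - t Q *: d)).
  move=> Q; exact: (continuous_comp (ch Q) (continuous_enorm _)).
apply: cle => Q.
  exact: (cvgM (cvg_cst H) (ce Q)).
exact: (cvgM (cvg_cst rho) (ct Q)).
Qed.

(** * Functions with continuous partial derivatives *)

(** Stated with the directional derivative along the line, since the functions
it will be applied to are given with their partial derivatives. *)
Lemma mean_value_line {R : realType} {V : normedModType R} {g : V -> R}
    {w e : V} {M a b : R} :
  (forall t, t \in `[Num.min a b, Num.max a b] ->
     derivable g (w + t *: e) e /\ `|'D_e g (w + t *: e)| <= M) ->
  `|g (w + b *: e) - g (w + a *: e)| <= M * `|b - a|.
Proof.
wlog ab : a b / a <= b => [hw|].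
  case/orP: (le_total a b) => [/hw//|ba].
  by rewrite minC maxC distrC (distrC b) => /(hw _ _ ba).
rewrite (min_idPl ab) (max_idPr ab) => gM.
pose f t := g (w + t *: e).
have fq t : (fun h => h^-1 *: ((f \o shift t) (h *: 1) - f t)) =
    (fun h => h^-1 *: ((g \o shift (w + t *: e)) (h *: e) - g (w + t *: e))).
  apply/funext => h; congr (_ *: (g _ - _)).
  by rewrite scalerDl /GRing.scale/= mulr1 addrCA.
have fd t : t \in `[a, b] -> is_derive t 1 f ('D_e g (w + t *: e)).
  move=> /gM[gd _]; split.
    by rewrite /derivable fq.
  by rewrite /derive fq.
have [] := MVT_segment ab (fun x xab => fd x (subset_itv_oo_cc xab)).
- by apply: derivable_within_continuous => x /fd [].
- move=> c /gM[_ gc]; rewrite /f => ->.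
  by rewrite normrM ler_wpM2r.
Qed.

Lemma coord_ler_norm {R : realType} {n : nat} (u : 'rV[R]_n) (j : 'I_n) :
  `|u 0 j| <= `|u|.
Proof.
by rewrite [leRHS]/Num.norm /= mx_normrE; apply/bigmax_geP; right => /=; exists (0, j).
Qed.

(** Near [p] all partial derivatives are bounded by some [M]. A ball of the sup
norm is a box, so two of its points are joined inside it by a path of [n]
segments parallel to the axes, and the mean value inequality on each segment
gives the Lipschitz constant [M *+ n]. *)
Lemma C1_locally_lipschitz {R : realType} {n : nat} {U : set 'rV[R]_n}
    {g : 'rV[R]_n -> R} {p : 'rV[R]_n} :
  open U -> U p ->
  (forall j u, U u -> derivable g u (delta_mx 0 j)) ->
  (forall j, {for p, continuous (fun v => 'D_(delta_mx 0 j) g v)}) ->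
  exists2 L : R, 0 <= L &
    exists B, [/\ nbhs p B, B `<=` U
      & forall u v, B u -> B v -> `|g u - g v| <= L * `|u - v|].
Proof.
move=> oU Up dg cg.
pose M := \sum_(j < n) (`|'D_(delta_mx 0 j) g p| + 1).
have M0 : 0 <= M by apply: sumr_ge0 => j _; rewrite addr_ge0.
exists (M *+ n); first by rewrite mulrn_wge0.
have DM : \forall v \near p, forall j, `|'D_(delta_mx 0 j) g v| <= M.
  refine (@filter_forall _ _
    (fun (j : 'I_n) v => `|'D_(delta_mx 0 j) g v| <= M) (nbhs p) _ _) => j.
  have : \forall v \near p, `|'D_(delta_mx 0 j) g v| < `|'D_(delta_mx 0 j) g p| + 1.
    by apply: (cvgr_lt _ (cvg_norm (cg j))); rewrite ltrDl.
  apply: filterS => v /ltW /le_trans; apply.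
  rewrite /M (bigD1 j) //= lerDl; apply: sumr_ge0 => k _.
  by rewrite addr_ge0.
have /nbhs_ballP[d /= d0 pd] :
    nbhs p (U `&` [set v | forall j, `|'D_(delta_mx 0 j) g v| <= M]).
  by apply: filterI => //; exact: open_nbhs_nbhs.
exists (ball p d); split.
- exact: nbhsx_ballx.
- by move=> v /pd[].
move=> u v [_ /(_ 0) pu] [_ /(_ 0) pv].
(* [path k] runs along the k-th segment: the coordinates before k have already
   moved to those of v, the k-th one is the parameter. *)
pose path k t : 'rV[R]_n := \row_l (if (l < k)%N then v 0 l else
  if l == k :> nat then t else u 0 l).
have pathE (k : 'I_n) t : path k t = path k 0 + t *: delta_mx 0 k.
  apply/rowP => l; rewrite !mxE eqxx /= -val_eqE /=.
  by case: ltngtP => _; rewrite ?mulr0 ?mulr1 ?addr0 ?add0r.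
have path_ball (k : 'I_n) t : t \in `[Num.min (u 0 k) (v 0 k), Num.max (u 0 k) (v 0 k)] ->
    ball p d (path k t).
  move=> tk; split=> // i l; rewrite ord1 mxE.
  case: ltngtP => // /val_inj ->.
  move: (pu k) (pv k) tk; rewrite /ball /= in_itv /= !ltr_norml.
  by case: (leP (u 0 k) (v 0 k)) => _; lra.
(* the corners of the path, from w 0 = u to w n = v *)
pose w k : 'rV[R]_n := \row_l (if (l < k)%N then v 0 l else u 0 l).
have wu (k : 'I_n) : w k = path k (u 0 k).
  apply/rowP => l; rewrite !mxE; case: ltngtP => // /val_inj -> //.
have wv (k : 'I_n) : w k.+1 = path k (v 0 k).
  apply/rowP => l; rewrite !mxE ltnS leq_eqVlt; case: ltngtP => // /val_inj -> //.
have -> : g u - g v = - \sum_(k < n) (g (w k.+1) - g (w k)).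
  rewrite -(big_mkord xpredT (fun k => g (w k.+1) - g (w k))).
  rewrite telescope_sumr // opprB; congr (g _ - g _); apply/rowP => l; rewrite !mxE //.
  by rewrite ltn_ord.
rewrite normrN; apply: le_trans (ler_norm_sum _ _ _) _.
rewrite mulrnAl -[X in _ *+ X](card_ord n) -sumr_const.
apply: ler_sum => k _; rewrite wu wv pathE (pathE k (u 0 k)).
apply: le_trans (mean_value_line (M := M) _) _ => [t /path_ball/pd|].
  by rewrite -pathE => -[? ?]; split; [exact: dg|].
rewrite ler_wpM2l// distrC; apply: le_trans _ (coord_ler_norm (u - v) k).
by rewrite !mxE.
Qed.

(** * Cones at boundary points *)

Lemma nbhs_eball {R : realType} {n : nat} (P : 'rV[R]_n) {r : R} :
  0 < r -> nbhs P (eball P r).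
Proof.
move=> r0.
have cB : continuous (fun Q : 'rV[R]_n => Q - P).
  by move=> Q; apply: continuousB; [exact: cvg_id|exact: cst_continuous].
have cE : {for P, continuous (fun Q : 'rV[R]_n => enorm (Q - P))}.
  exact: (continuous_comp (cB P) (continuous_enorm _)).
apply: (cvgr_lt _ cE); rewrite subrr /enorm.
by rewrite /dotp big1 ?sqrtr0 // => j _; rewrite mxE mul0r.
Qed.

Lemma compact_boundary {R : realType} {n : nat} {A : set 'rV[R]_n} :
  bounded_set A -> compact (boundary A).
Proof.
move=> [M [Mreal AM]]; apply: bounded_closed_compact; last first.
  apply: closedI; first exact: closed_closure.
  by apply: open_closedC; exact: open_interior.
exists (M + 1); split; first by rewrite realD// real1.
move=> K MK x [clAx _].
have clK : closed [set x : 'rV[R]_n | `|x| <= K].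
  apply: (@preimage_closed _ _ (fun x : 'rV[R]_n => `|x|) [set y : R | y <= K]).
    by move=> y _; exact: norm_continuous.
  exact: closed_le.
suff AK : A `<=` [set x : 'rV[R]_n | `|x| <= K].
  by have := closure_subset AK clAx; rewrite -(closure_id _).1.
by move=> y; apply: AM; apply: lt_trans MK; rewrite ltrDl.
Qed.

(** For a cone along a coordinate axis, [t] is the signed height above the vertex
and the coordinates other than [i] are those of the radial component. *)
Lemma cone_coord {R : realType} {Q x : 'rV[R]_3} {i : 'I_3} {b : bool} {s : R} :
  0 < s -> right_circular_cone Q ((-1) ^+ b *: delta_mx 0 i) s (s ^+ 2) x ->
  let t := (-1) ^+ b * (x 0 i - Q 0 i) in
  [/\ 0 <= t <= s, enorm (x - Q - t *: ((-1) ^+ b *: delta_mx 0 i)) <= s * t &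
      forall j, j != i -> `|x 0 j - Q 0 j| <= s * t].
Proof.
move=> s0; rewrite /right_circular_cone /= dotpZr dotp_delta !mxE => -[tb].
set t := _ * (_ - _); rewrite expr2 -mulrA ler_pM2l// => hs; split=> // j ji.
apply: le_trans hs; apply: le_trans (coord_le_enorm _ j).
by rewrite !mxE (negPf ji) andbF !mulr0 subr0.
Qed.

(** The radius is [s ^+ 2] so that height and slope both tend to zero with the
single parameter [s]. *)
Definition exterior_cone_at {R : realType} (Omega : set 'rV[R]_3) (s : R)
    (Q : 'rV[R]_3) : Prop :=
  exists2 d, enorm d = 1 &
    right_circular_cone Q d s (s ^+ 2) `&` closure Omega `<=` [set Q].

(** The height bound keeps the cone inside the neighbourhood where [Omega] is
bounded by the graph; the slope bound makes it steeper than the graph. *)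
Lemma exterior_cone_near {R : realType} {alpha : R} {Omega : set 'rV[R]_3}
    {P : 'rV[R]_3} :
  open Omega -> C1alpha_boundary alpha Omega -> boundary Omega P ->
  \forall Q \near P & s \near 0^'+,
    boundary Omega Q -> exterior_cone_at Omega s Q.
Proof.
move=> oO C1 bP; have [r [i [U [g [below [r0 [oU C1g] bG OG]]]]]] := C1 P bP.
have PN := nbhs_eball P r0.
have [UP _] := (bG P (nbhs_singleton PN)).1 bP.
have [L L0 [B [pB BU Blip]]] : exists2 L : R, 0 <= L &
  exists B : set 'rV[R]_2, [/\ nbhs (col' i P) B, B `<=` U &
     forall u v, B u -> B v -> `|g u - g v| <= L * `|u - v| ].
  apply: C1_locally_lipschitz => //.
  - by move=> j u /(let: And3 h _ _ := C1g j in h u).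
  - by move=> j; have [_ + _] := C1g j; apply.
have [e e0 Pe] : exists2 e, 0 < e &
    ball P e `<=` eball P r `&` (@col' R 1 3 i @^-1` B).
  move/nbhs_ballP : pB => [e /= e0 pe].
  apply/nbhs_ballP; apply: filterI => //; apply/nbhs_ballP; exists e => //.
  move=> Q [_ PQ]; apply: pe; split=> // k l; rewrite !mxE; exact: PQ.
have e20 : 0 < e / 2 by rewrite divr_gt0.
near=> Q s => /= bQ.
have s0 : 0 < s by near: s; exact: nbhs_right_gt.
have s1 : s < 1 by near: s; exact: nbhs_right_lt.
have se : s < e / 2 by near: s; exact: nbhs_right_lt.
have sL : s < (L + 1)^-1 by near: s; apply: nbhs_right_lt; rewrite invr_gt0; lra.
have PQ : ball P (e / 2) Q by near: Q; exact: nbhsx_ballx.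
have sL1 : s * (L + 1) < 1 by rewrite -ltr_pdivlMr ?mul1r//; lra.
(* the axis points away from Omega: upwards when Omega is below the graph *)
exists ((-1) ^+ (~~ below) *: delta_mx 0 i).
  by case: (below); rewrite /= ?expr0 ?expr1 ?scale1r ?scaleN1r ?enormN enorm_delta.
move=> x [/(cone_coord s0)]; set t := _ * _ => -[/andP[t0 ts] hx hj] clx.
have stt : s * t <= t by rewrite ler_piMl// ltW.
have Qx : ball Q (e / 2) x.
  split=> // k j; rewrite !ord1 /ball /= distrC; apply: le_lt_trans se.
  apply: le_trans ts; have [->|/hj] := eqVneq j i; last by move/le_trans; apply.
  by rewrite -(ger0_norm t0) /t normrM normrX normrN1 expr1n mul1r.
have [rx Bx] := Pe _ (ball_splitl PQ (ball_sym Qx)).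
have [rQ BQ] := Pe _ (ball_splitl PQ (ballxx Q e20)).
have [_ QG] := (bG Q rQ).1 bQ.
(* x is in the closure of Omega, hence in Omega or on the graph *)
have xG : (-1) ^+ (~~ below) * x 0 i <= (-1) ^+ (~~ below) * g (col' i x).
  have [Ox|nOx] := pselect (Omega x).
    move: ((OG x rx (BU _ Bx)).1 Ox).
    by case: (below) => /ltW; rewrite /= ?expr0 ?expr1 ?mul1r// !mulN1r lerN2.
  have bx : boundary Omega x by split=> //; rewrite (interior_id _).1.
  by have [_ ->] := (bG x rx).1 bx.
have gL : (-1) ^+ (~~ below) * (g (col' i x) - g (col' i Q)) <= L * (s * t).
  apply: le_trans (ler_norm _) _; rewrite normrM normrX normrN1 expr1n mul1r.
  apply: le_trans (Blip _ _ Bx BQ) _; rewrite ler_wpM2l//.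
  rewrite [leLHS]/Num.norm /= mx_normrE; apply/bigmax_leP; split=> [|[k j] _ /=].
    by rewrite mulr_ge0// ltW.
  by rewrite !mxE (ord1 k); apply: hj; rewrite eq_sym neq_lift.
have t00 : t = 0.
  have tL : t <= L * (s * t) by apply: le_trans gL; rewrite /t QG; lra.
  nra.
apply/eqP; rewrite -subr_eq0; apply/eqP/enorm_eq0/eqP.
rewrite eq_le sqrtr_ge0 andbT; move: hx.
by rewrite t00 scale0r subr0 mulr0.
Unshelve. all: end_near. Qed.

(** * The uniform exterior cone condition *)

Theorem theorem2p1 (R : realType) (alpha : R) (Omega : set 'rV[R]_3)
    (alpha_gt0 : 0 < alpha) (alpha_le1 : alpha <= 1)
    (Omega_domain : is_domain Omega) (Omega_bounded : bounded_set Omega)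
    (Omega_C1alpha : C1alpha_boundary alpha Omega) :
  uniform_exterior_cone Omega.
Proof.
have [oO _ _] := Omega_domain.
have /compact_near_coveringP cov := compact_boundary Omega_bounded.
have near_cones : \forall s \near 0^'+,
    boundary Omega `<=` [set Q | boundary Omega Q -> exterior_cone_at Omega s Q].
  by apply: cov => P bP; exact: exterior_cone_near Omega_C1alpha bP.
near (0 : R)^'+ => s.
have s0 : 0 < s by near: s; exact: nbhs_right_gt.
have cones : boundary Omega `<=`
    [set Q | boundary Omega Q -> exterior_cone_at Omega s Q] by near: s.
pose e1 : 'rV[R]_3 := delta_mx 0 0.
exists (right_circular_cone 0 e1 s (s ^+ 2)); split.
  by exists 0, e1, s, (s ^+ 2); rewrite enorm_delta exprn_gt0.
move=> P bP; have [d d1 Pd] := cones P bP bP.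
exists (right_circular_cone P d s (s ^+ 2)); split.
- by exists d, s, (s ^+ 2); rewrite d1 exprn_gt0.
- rewrite -(closure_id _).1; last exact: closed_cone.
  apply/seteqP; split=> // _ ->; split; last by case: bP.
  rewrite /right_circular_cone /= subrr -(scale0r d) dotpZl mul0r lexx ltW//=.
  by split=> //; rewrite scale0r subr0 -(scale0r d) /enorm dotpZl mul0r sqrtr0 !mulr0.
- by apply: congruent_cones => //; exact: enorm_delta.
Unshelve. all: end_near. Qed.
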